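(* The set of indices of computable lattices that are complete is $\Pi^1_1$.
   Context: A computable lattice $(L,\preceq)$ has underlying set $L=\omega$ and a computable lattice ordering $\preceq$, formally a computable subset of $\omega^2$. An index of a computable lattice is a number $e$ such that the partial computable function $\varphi_e$ is (total and is) the characteristic function of a lattice ordering $\preceq\subseteq\omega^2$ on $\omega$. A lattice $(L,\preceq)$ is complete if for each subset $S\subseteq L$, both $\sup S$ and $\inf S$ exist. A set $C\subseteq\omega$ is $\Pi^1_1$ if it has the form $\{n\in\omega\mid \forall f\in\omega^\omega\ \varphi_e^f(n)\downarrow\}$ for some $e$. *)

(* Defs.v *)
From Stdlib Require Import Arith Lia Cantor Relations.

(** Partial recursive functions are unary here; several arguments are packed
    with the Cantor pairing bijection. *)

Definition pr (x y : nat) : nat := Cantor.to_nat (x, y).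

Inductive prog : Type :=
| Zero
| Succ
| Fst
| Snd
| Oracle
| Pair (p q : prog)
| Comp (p q : prog)
| Prec (p q : prog)
| Mu (p : prog).

(** [eval f p x y]: the program [p] with oracle [f] halts on input [x] with
    output [y].  The identity is [Pair Fst Snd].  [Prec p q] is the function
    [h] with [h(a,0) = p(a)] and [h(a,m+1) = q(a,(m,h(a,m)))]; [Mu p] maps [x]
    to the least [y] with [p(x,y) = 0], all earlier values being defined. *)
Fixpoint eval (f : nat -> nat) (p : prog) (x y : nat) : Prop :=
  match p with
  | Zero => y = 0
  | Succ => y = S x
  | Fst => y = fst (Cantor.of_nat x)
  | Snd => y = snd (Cantor.of_nat x)
  | Oracle => y = f x
  | Pair p q => exists u v, eval f p x u /\ eval f q x v /\ y = pr u v
  | Comp p q => exists u, eval f q x u /\ eval f p u y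
  | Prec p q =>
      let a := fst (Cantor.of_nat x) in
      let n := snd (Cantor.of_nat x) in
      nat_rect (fun _ => nat -> Prop)
        (eval f p a)
        (fun m h z => exists u, h u /\ eval f q (pr a (pr m u)) z)
        n y
  | Mu p => eval f p (pr x y) 0 /\
            forall m, m < y -> exists k, eval f p (pr x m) (S k)
  end.

Fixpoint code (p : prog) : nat :=
  match p with
  | Zero => pr 0 0
  | Succ => pr 1 0
  | Fst => pr 2 0
  | Snd => pr 3 0
  | Oracle => pr 4 0
  | Pair p q => pr 5 (pr (code p) (code q))
  | Comp p q => pr 6 (pr (code p) (code q))
  | Prec p q => pr 7 (pr (code p) (code q))
  | Mu p => pr 8 (code p)
  end.

(** [Phi f e x y] is φ_e^f(x) = y.  If [e] codes no program, φ_e^f is the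
    nowhere defined function. *)
Definition Phi (f : nat -> nat) (e x y : nat) : Prop :=
  exists p, code p = e /\ eval f p x y.

Definition Phi_halts (f : nat -> nat) (e x : nat) : Prop :=
  exists y, Phi f e x y.

(** φ_e, taken as φ_e^∅ (the empty oracle being the constant function 0). *)
Definition phi (e x y : nat) : Prop := Phi (fun _ => 0) e x y.

Lemma pr_inj a b c d : pr a b = pr c d -> a = c /\ b = d.
Proof.
  unfold pr; intros H; apply Cantor.to_nat_inj in H.
  now injection H.
Qed.

Lemma code_inj p q : code p = code q -> p = q.
Proof.
  revert q; induction p; intros [] H; cbn [code] in H;
    apply pr_inj in H; destruct H as [H1 H2]; try discriminate H1;
    try reflexivity; try (apply pr_inj in H2; destruct H2); f_equal; auto.
Qed.

Lemma eval_fun f p x y z : eval f p x y -> eval f p x z -> y = z.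
Proof.
  revert x y z; induction p; cbn [eval]; intros x y z; try congruence.
  - intros (u & v & Hu & Hv & ->) (u' & v' & Hu' & Hv' & ->).
    f_equal; eauto.
  - intros (u & Hu & Hy) (u' & Hu' & Hz).
    assert (u = u') by eauto; subst; eauto.
  - cbv zeta. generalize (fst (Cantor.of_nat x)) as a.
    intros a; revert y z.
    induction (snd (Cantor.of_nat x)) as [|n IH]; cbn [nat_rect]; intros y z.
    + apply IHp1.
    + intros (u & Hu & Hy) (u' & Hu' & Hz).
      assert (u = u') by (eapply IH; eassumption); subst; eauto.
  - intros [Hy Hlty] [Hz Hltz].
    destruct (Nat.lt_trichotomy y z) as [Hlt|[Heq|Hlt]]; [|exact Heq|].
    + destruct (Hltz y Hlt) as [k Hk]. discriminate (IHp _ _ _ Hy Hk).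
    + destruct (Hlty z Hlt) as [k Hk]. discriminate (IHp _ _ _ Hz Hk).
Qed.

Lemma Phi_fun f e x y z : Phi f e x y -> Phi f e x z -> y = z.
Proof.
  intros (p & Hp & Hy) (q & Hq & Hz).
  assert (p = q) by (apply code_inj; congruence); subst.
  eapply eval_fun; eassumption.
Qed.

Definition Pi11 (C : nat -> Prop) : Prop :=
  exists e, forall n, C n <-> forall f : nat -> nat, Phi_halts f e n.

Definition is_sup (R : relation nat) (S : nat -> Prop) (s : nat) : Prop :=
  (forall x, S x -> R x s) /\ (forall u, (forall x, S x -> R x u) -> R s u).

Definition is_inf (R : relation nat) (S : nat -> Prop) (i : nat) : Prop :=
  (forall x, S x -> R i x) /\ (forall l, (forall x, S x -> R l x) -> R l i).

Definition lattice_order (R : relation nat) : Prop :=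
  order nat R /\
  forall x y, (exists s, is_sup R (fun z => z = x \/ z = y) s) /\
              (exists i, is_inf R (fun z => z = x \/ z = y) i).

Definition complete (R : relation nat) : Prop :=
  forall S : nat -> Prop, (exists s, is_sup R S s) /\ (exists i, is_inf R S i).

(** Since [pr] is onto, this forces φ_e to be total. *)
Definition char_index (e : nat) (R : relation nat) : Prop :=
  forall x y, (R x y /\ phi e (pr x y) 1) \/ (~ R x y /\ phi e (pr x y) 0).

Definition computable_lattice_index (e : nat) (R : relation nat) : Prop :=
  char_index e R /\ lattice_order R.

(* Main.v *)
From Stdlib Require Import Arith Lia Cantor Relations.
From Stdlib Require Import Classical IndefiniteDescription.
Require Import Defs.

(** A set of numbers is [Pi11] as soon as its complement has the form
    [exists f, Q f n], where [Q] is a universal number quantifier in front of a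
    condition decidable from [f] ([Pi11_of_Pi01]): a program can search for a
    counterexample to [Q f n] and halt when it finds one.  So it is enough to
    describe a witness [f] that refutes [n], that is, shows that [n] is not an
    index of a complete lattice, in such a way that checking [f] is [Pi01]
    ([refutes], [Pi01_refutes]).

    The obstacle is that [f] has to speak about the values of φ_n, and that
    statements such as the divergence of φ_n at some point are not decidable.
    No universal program is used.  Instead, one column of [f] claims to be the
    graph of all the functions φ_e at once, with 0 for undefined.  The checker
    tests only that these claims are closed under the evaluation rules
    ([simulates]).  By induction on programs, every true value must then be
    claimed ([simulates_eval]), but where φ_e diverges [f] may also claim
    spurious values.  This one-sided correctness suffices: if [n] really is an index
    of a complete lattice, φ_n is total, so [f] is right about all of φ_n and
    cannot refute [n] ([complete_not_refuted]).  Conversely the true graph is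
    closed under the rules ([simulates_exists]), so if [n] is not such an index
    it can be completed to a refutation ([not_refuted_complete]): the other
    columns hold either points at which φ_n fails to be the characteristic
    function of an order, or a set without supremum together with a function
    that gives for each [s] a reason why [s] is not its supremum.

    Suprema suffice, since they give infima ([sups_complete]), and
    completeness contains the existence of binary suprema and infima. *)

Definition lft (z : nat) : nat := fst (Cantor.of_nat z).
Definition rgt (z : nat) : nat := snd (Cantor.of_nat z).

Lemma lft_pr x y : lft (pr x y) = x.
Proof. unfold lft, pr; now rewrite Cantor.cancel_of_to. Qed.

Lemma rgt_pr x y : rgt (pr x y) = y.
Proof. unfold rgt, pr; now rewrite Cantor.cancel_of_to. Qed.

Lemma pr_lft_rgt z : pr (lft z) (rgt z) = z.
Proof.
  unfold lft, rgt, pr; rewrite <- surjective_pairing.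
  apply Cantor.cancel_to_of.
Qed.

(** * Total recursive functionals *)

Definition recursive (F : (nat -> nat) -> nat -> nat) : Prop :=
  exists p, forall f x, eval f p x (F f x).

Lemma recursive_ext F G :
  (forall f x, F f x = G f x) -> recursive F -> recursive G.
Proof. intros E [p Hp]; exists p; intros; rewrite <- E; apply Hp. Qed.

Lemma recursive_id : recursive (fun _ x => x).
Proof.
  exists (Pair Fst Snd); intros f x; cbn.
  exists (lft x), (rgt x); repeat split; symmetry; apply pr_lft_rgt.
Qed.

Lemma recursive_comp F G :
  recursive F -> recursive G -> recursive (fun f x => F f (G f x)).
Proof.
  intros [p Hp] [q Hq]; exists (Comp p q); intros f x; cbn.
  exists (G f x); auto.
Qed.

Lemma recursive_succ G : recursive G -> recursive (fun f x => S (G f x)).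
Proof. apply (recursive_comp (fun _ => S)); exists Succ; reflexivity. Qed.

Lemma recursive_lft G : recursive G -> recursive (fun f x => lft (G f x)).
Proof. apply (recursive_comp (fun _ => lft)); exists Fst; reflexivity. Qed.

Lemma recursive_rgt G : recursive G -> recursive (fun f x => rgt (G f x)).
Proof. apply (recursive_comp (fun _ => rgt)); exists Snd; reflexivity. Qed.

Lemma recursive_oracle G : recursive G -> recursive (fun f x => f (G f x)).
Proof. apply (recursive_comp (fun f => f)); exists Oracle; reflexivity. Qed.

Lemma recursive_pr F G :
  recursive F -> recursive G -> recursive (fun f x => pr (F f x) (G f x)).
Proof.
  intros [p Hp] [q Hq]; exists (Pair p q); intros f x; cbn.
  exists (F f x), (G f x); auto.
Qed.

Lemma recursive_const c : recursive (fun _ _ => c).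
Proof.
  induction c as [|c IH]; [exists Zero; reflexivity | now apply recursive_succ].
Qed.

(** The programs [Prec p q] recurse on the second component of their input, so
    the recursion bound [N f x] is first paired with [x], which stays available
    as the parameter. *)
Lemma recursive_nat_rect N A B :
  recursive N -> recursive A -> recursive B ->
  recursive (fun f x => nat_rect (fun _ => nat) (A f x)
                          (fun m u => B f (pr x (pr m u))) (N f x)).
Proof.
  intros HN [p Hp] [q Hq].
  enough (recursive (fun f z => nat_rect (fun _ => nat) (A f (lft z))
            (fun m u => B f (pr (lft z) (pr m u))) (rgt z))) as H.
  { refine (recursive_ext _ _ _
              (recursive_comp _ _ H (recursive_pr _ _ recursive_id HN))).
    intros f x; cbv beta; now rewrite lft_pr, rgt_pr. }
  exists (Prec p q); intros f z; cbn [eval]; cbv zeta.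
  fold (lft z) (rgt z).
  induction (rgt z) as [|m IH]; cbn [nat_rect]; [apply Hp|].
  eexists; split; [exact IH | apply Hq].
Qed.

Lemma recursive_if0 N A B :
  recursive N -> recursive A -> recursive B ->
  recursive (fun f x => if N f x =? 0 then A f x else B f x).
Proof.
  intros HN HA HB.
  eapply recursive_ext;
    [|exact (recursive_nat_rect N A (fun f z => B f (lft z)) HN HA
               (recursive_comp _ _ HB (recursive_lft _ recursive_id)))].
  intros f x; cbv beta; destruct (N f x); cbn [nat_rect Nat.eqb];
    now rewrite ?lft_pr.
Qed.

Lemma recursive_pred G :
  recursive G -> recursive (fun f x => Nat.pred (G f x)).
Proof.
  intros HG.
  eapply recursive_ext;
    [|exact (recursive_nat_rect G _ (fun _ z => lft (rgt z)) HG (recursive_const 0)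
               (recursive_lft _ (recursive_rgt _ recursive_id)))].
  intros f x; cbv beta; destruct (G f x); cbn [nat_rect Nat.pred];
    now rewrite ?rgt_pr, ?lft_pr.
Qed.

Lemma recursive_sub F G :
  recursive F -> recursive G -> recursive (fun f x => F f x - G f x).
Proof.
  intros HF HG.
  eapply recursive_ext;
    [|exact (recursive_nat_rect G F (fun _ z => Nat.pred (rgt (rgt z))) HG HF
               (recursive_pred _ (recursive_rgt _ (recursive_rgt _ recursive_id))))].
  intros f x; cbv beta; induction (G f x) as [|m IH]; cbn [nat_rect]; [lia|].
  rewrite IH, !rgt_pr; lia.
Qed.

(** * Decidable conditions on an oracle and a number *)

(** The value 0 means true, so that a minimisation program can search for a
    point that satisfies the condition. *)
Definition decidable (Q : (nat -> nat) -> nat -> Prop) : Prop :=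
  exists F, recursive F /\ forall f x, F f x = 0 <-> Q f x.

Lemma decidable_comp Q G :
  decidable Q -> recursive G -> decidable (fun f x => Q f (G f x)).
Proof.
  intros (F & HF & E) HG; exists (fun f x => F f (G f x)); split;
    [now apply recursive_comp | intros; apply E].
Qed.

Lemma decidable_eq F G :
  recursive F -> recursive G -> decidable (fun f x => F f x = G f x).
Proof.
  intros HF HG.
  exists (fun f x => if F f x - G f x =? 0 then G f x - F f x else 1); split.
  - apply recursive_if0; auto using recursive_sub, recursive_const.
  - intros f x; destruct (Nat.eqb_spec (F f x - G f x) 0); lia.
Qed.

Lemma decidable_imp P Q :
  decidable P -> decidable Q -> decidable (fun f x => P f x -> Q f x).
Proof.
  intros (F & HF & EF) (G & HG & EG).
  exists (fun f x => if F f x =? 0 then G f x else 0); split.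
  - apply recursive_if0; auto using recursive_const.
  - intros f x; specialize (EF f x); specialize (EG f x).
    destruct (Nat.eqb_spec (F f x) 0); tauto.
Qed.

Lemma decidable_not P : decidable P -> decidable (fun f x => ~ P f x).
Proof.
  intros HP; apply decidable_imp; [exact HP|].
  exists (fun _ _ => 1); split; [apply recursive_const | easy].
Qed.

Lemma decidable_and P Q :
  decidable P -> decidable Q -> decidable (fun f x => P f x /\ Q f x).
Proof.
  intros (F & HF & EF) (G & HG & EG).
  exists (fun f x => if F f x =? 0 then G f x else 1); split.
  - apply recursive_if0; auto using recursive_const.
  - intros f x; rewrite <- EF, <- EG.
    destruct (Nat.eqb_spec (F f x) 0); intuition lia.
Qed.

Lemma decidable_or P Q :
  decidable P -> decidable Q -> decidable (fun f x => P f x \/ Q f x).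
Proof.
  intros (F & HF & EF) (G & HG & EG).
  exists (fun f x => if F f x =? 0 then 0 else G f x); split.
  - apply recursive_if0; auto using recursive_const.
  - intros f x; rewrite <- EF, <- EG.
    destruct (Nat.eqb_spec (F f x) 0); intuition lia.
Qed.

(** * Universal number quantifiers and the Pi11 normal form *)

Definition Pi01 (Q : (nat -> nat) -> nat -> Prop) : Prop :=
  exists D, decidable D /\ forall f n, Q f n <-> forall k, D f (pr n k).

Lemma Pi01_decidable Q : decidable Q -> Pi01 Q.
Proof.
  intros HQ; exists (fun f z => Q f (lft z)); split.
  - apply decidable_comp; [exact HQ | apply recursive_lft, recursive_id].
  - intros f n; split; intros H.
    + intros k; now rewrite lft_pr.
    + specialize (H 0); now rewrite lft_pr in H.
Qed.

(** The quantified number is paired with the argument.  Since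
    [lft] and [rgt] are recursive, nested quantifiers are removed one at a time
    and no tuples have to be written. *)
Lemma Pi01_forall (P : (nat -> nat) -> nat -> nat -> Prop) :
  Pi01 (fun f z => P f (lft z) (rgt z)) -> Pi01 (fun f n => forall x, P f n x).
Proof.
  intros (D & HD & E).
  exists (fun f z => D f (pr (pr (lft z) (lft (rgt z))) (rgt (rgt z)))); split.
  - apply (decidable_comp D); [exact HD|].
    auto 6 using recursive_pr, recursive_lft, recursive_rgt, recursive_id.
  - intros f n; split; intros H.
    + intros k; rewrite lft_pr, rgt_pr; apply E.
      rewrite lft_pr, rgt_pr; apply H.
    + intros x; specialize (E f (pr n x)); cbv beta in E.
      rewrite lft_pr, rgt_pr in E; apply E; intros k.
      specialize (H (pr x k)); now rewrite !lft_pr, !rgt_pr, lft_pr in H.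
Qed.

Lemma Pi01_and P Q :
  Pi01 P -> Pi01 Q -> Pi01 (fun f n => P f n /\ Q f n).
Proof.
  intros (D & HD & E) (D' & HD' & E').
  exists (fun f z => D f z /\ D' f z); split; [now apply decidable_and|].
  intros f n; rewrite E, E'; firstorder.
Qed.

(** Two independent instances [k] and [k'] are checked at the same time: if both
    disjuncts fail, a pair of counterexamples refutes the combined matrix. *)
Lemma Pi01_or P Q :
  Pi01 P -> Pi01 Q -> Pi01 (fun f n => P f n \/ Q f n).
Proof.
  intros (D & HD & E) (D' & HD' & E').
  exists (fun f z => D f (pr (lft z) (lft (rgt z))) \/
                     D' f (pr (lft z) (rgt (rgt z)))); split.
  - apply decidable_or; apply decidable_comp; trivial;
      auto using recursive_pr, recursive_lft, recursive_rgt, recursive_id.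
  - intros f n; rewrite E, E'; split.
    + intros H k; rewrite lft_pr, rgt_pr; destruct H; auto.
    + intros H; apply NNPP; intros N; apply not_or_and in N.
      destruct N as [N N'].
      apply not_all_ex_not in N; apply not_all_ex_not in N'.
      destruct N as [k N], N' as [k' N'].
      specialize (H (pr k k')); rewrite !lft_pr, !rgt_pr, lft_pr in H; tauto.
Qed.

Lemma recursive_search F :
  recursive F ->
  exists e, forall f n, Phi_halts f e n <-> exists k, F f (pr n k) = 0.
Proof.
  intros [p Hp]; exists (code (Mu p)); intros f n; split.
  - intros (y & q & Hq & Hy); apply code_inj in Hq; subst q.
    exists y; exact (eval_fun _ _ _ _ _ (Hp _ _) (proj1 Hy)).
  - intros Hk.
    destruct (dec_inh_nat_subset_has_unique_least_element
                (fun k => F f (pr n k) = 0)) as (y & [Hy Hmin] & _);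
      [intros k; destruct (Nat.eq_dec (F f (pr n k)) 0); tauto | exact Hk |].
    exists y, (Mu p); split; [reflexivity|]; split.
    + rewrite <- Hy; apply Hp.
    + intros m Hm; exists (Nat.pred (F f (pr n m))).
      replace (S _) with (F f (pr n m)); [apply Hp|].
      destruct (F f (pr n m)) eqn:E; [|reflexivity].
      specialize (Hmin m E); lia.
Qed.

Lemma Pi11_of_Pi01 Q : Pi01 Q -> Pi11 (fun n => forall f, ~ Q f n).
Proof.
  intros (D & HD & E); apply decidable_not in HD.
  destruct HD as (F & HF & EF).
  destruct (recursive_search F HF) as [e He].
  exists e; intros n.
  split; intros H f; specialize (H f).
  - apply He; rewrite E in H; apply not_all_ex_not in H.
    destruct H as [k Hk]; exists k; now apply EF.
  - apply He in H; destruct H as [k Hk]; apply EF in Hk.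
    rewrite E; auto.
Qed.

(** * Simulation of the partial recursive functions by an oracle *)

(** The oracle [f] is read in columns [fun z => f (pr i z)].  Columns 0, 1 and 2
    claim to know which numbers code programs, the functions φ_e, and how far
    the search of a minimisation program gets. *)
Definition valid (f : nat -> nat) (e : nat) : Prop := f (pr 0 e) = 1.

(** [S y] stands for the value [y], and 0 for an undefined value. *)
Definition val (f : nat -> nat) (e x : nat) : nat := f (pr 1 (pr e x)).

(** Intended meaning: φ_e(x,i) is defined and nonzero for all [i < m].  It turns
    the bounded quantifier in the evaluation of [Mu] into rules that extend the
    bound by one. *)
Definition nonzero_below (f : nat -> nat) (e x m : nat) : Prop :=
  f (pr 2 (pr e (pr x m))) = 1.

(** One rule for each way to code a program, to obtain a value or to advance a
    search; the tags 5, 6, 7 and 8 are those of [Pair], [Comp], [Prec] and [Mu].  All rules are positive,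
    so they force true values to be claimed but not undefined ones to be 0.  The
    premise [valid f b] in the base rule for [Prec] is needed for the true graph
    to obey the rules: there [b] is not evaluated, and if it codes no program
    then neither does [pr 7 (pr a b)]. *)
Definition simulates (f : nat -> nat) : Prop :=
  (valid f (code Zero) /\ valid f (code Succ) /\ valid f (code Fst) /\
   valid f (code Snd) /\ valid f (code Oracle)) /\
  (forall a b, valid f a -> valid f b ->
     valid f (pr 5 (pr a b)) /\ valid f (pr 6 (pr a b)) /\
     valid f (pr 7 (pr a b))) /\
  (forall a, valid f a -> valid f (pr 8 a)) /\
  (forall x, val f (code Zero) x = 1 /\
     val f (code Succ) x = S (S x) /\
     val f (code Fst) x = S (lft x) /\
     val f (code Snd) x = S (rgt x) /\
     val f (code Oracle) x = 1) /\
  (forall a b x u v, val f a x = S u -> val f b x = S v ->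
     val f (pr 5 (pr a b)) x = S (pr u v)) /\
  (forall a b x u v, val f b x = S u -> val f a u = S v ->
     val f (pr 6 (pr a b)) x = S v) /\
  (forall a b x u, valid f b -> val f a x = S u ->
     val f (pr 7 (pr a b)) (pr x 0) = S u) /\
  (forall a b x m u v, val f (pr 7 (pr a b)) (pr x m) = S u ->
     val f b (pr x (pr m u)) = S v ->
     val f (pr 7 (pr a b)) (pr x (S m)) = S v) /\
  (forall a x, nonzero_below f a x 0) /\
  (forall a x m u, nonzero_below f a x m -> val f a (pr x m) = S (S u) ->
     nonzero_below f a x (S m)) /\
  (forall a x m, nonzero_below f a x m -> val f a (pr x m) = 1 ->
     val f (pr 8 a) x = S m).

Lemma simulates_valid f p : simulates f -> valid f (code p).
Proof.
  intros (H0 & H2 & H1 & _).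
  induction p; cbn [code]; try (apply H1; assumption);
    try (now apply (H2 (code p1) (code p2))); apply H0.
Qed.

Lemma simulates_eval f p x y :
  simulates f -> eval (fun _ => 0) p x y -> val f (code p) x = S y.
Proof.
  intros Hf; pose proof (fun p => simulates_valid f p Hf) as Hvalid.
  destruct Hf as (_ & _ & _ & Hbase & Hpair & Hcomp & Hprec0 & HprecS &
                  Hnz0 & HnzS & Hmu).
  revert x y; induction p; intros x y; cbn [eval].
  1-5: intros ->; apply Hbase.
  - intros (u & v & Hu & Hv & ->); apply Hpair; auto.
  - intros (u & Hu & Hv); apply (Hcomp _ _ _ u); auto.
  - cbv zeta; fold (lft x) (rgt x).
    rewrite <- (pr_lft_rgt x) at 3.
    revert y; induction (rgt x) as [|m IH]; cbn [nat_rect]; intros y.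
    + intros Hy; apply Hprec0; auto.
    + intros (u & Hu & Hy); apply (HprecS _ _ _ _ u); [apply IH, Hu | auto].
  - intros [Hy Hlt]; apply Hmu; [|auto].
    clear Hy; induction y as [|m IH]; [apply Hnz0|].
    destruct (Hlt m) as [k Hk]; [lia|].
    apply (HnzS _ _ _ k); auto.
Qed.

Lemma char_function (P : nat -> Prop) :
  exists c : nat -> nat, forall z, c z = 1 <-> P z.
Proof.
  apply (functional_choice (fun z v => v = 1 <-> P z)).
  intros z; destruct (classic (P z)); [exists 1 | exists 0]; intuition lia.
Qed.

(** Divergence is undecidable, so the default value 0 is obtained from classical
    logic and choice. *)
Lemma graph_function :
  exists V : nat -> nat, forall e x y, V (pr e x) = S y <-> phi e x y.
Proof.
  destruct (functional_choice
    (fun z v => forall y, v = S y <-> phi (lft z) (rgt z) y)) as [V HV].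
  - intros z; destruct (classic (exists y, phi (lft z) (rgt z) y)) as [[y Hy]|N].
    + exists (S y); intros y'; split.
      * now intros [= <-].
      * intros Hy'; f_equal; eapply Phi_fun; eassumption.
    + exists 0; intros y; split; [discriminate | intros Hy; destruct N; eauto].
  - exists V; intros e x y; rewrite HV, lft_pr, rgt_pr; reflexivity.
Qed.

(** The next five lemmas say that the true graph obeys the rules of
    [simulates], for arbitrary numbers [a] and [b], not only for codes. *)
Lemma phi_Pair a b x u v :
  phi a x u -> phi b x v -> phi (pr 5 (pr a b)) x (pr u v).
Proof.
  intros (p & <- & Hp) (q & <- & Hq); exists (Pair p q); split; [reflexivity|].
  exists u, v; auto.
Qed.

Lemma phi_Comp a b x u v :
  phi b x u -> phi a u v -> phi (pr 6 (pr a b)) x v.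
Proof.
  intros (q & <- & Hq) (p & <- & Hp); exists (Comp p q); split; [reflexivity|].
  exists u; auto.
Qed.

Lemma phi_Prec_0 a q x u :
  phi a x u -> phi (pr 7 (pr a (code q))) (pr x 0) u.
Proof.
  intros (p & <- & Hp); exists (Prec p q); split; [reflexivity|].
  cbn [eval]; cbv zeta; fold (lft (pr x 0)) (rgt (pr x 0)).
  now rewrite lft_pr, rgt_pr.
Qed.

Lemma phi_Prec_S a b x m u v :
  phi (pr 7 (pr a b)) (pr x m) u -> phi b (pr x (pr m u)) v ->
  phi (pr 7 (pr a b)) (pr x (S m)) v.
Proof.
  intros (r & Hr & Hu) (q & <- & Hq).
  destruct r as [| | | | | p q'|p q'|p q'|p]; cbn [code] in Hr;
    apply pr_inj in Hr; destruct Hr as [Htag Hr]; try discriminate Htag.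
  apply pr_inj in Hr; destruct Hr as [<- Hr].
  apply code_inj in Hr; subst q'.
  exists (Prec p q); split; [reflexivity|].
  revert Hu; cbn [eval]; cbv zeta.
  fold (lft (pr x m)) (rgt (pr x m)) (lft (pr x (S m))) (rgt (pr x (S m))).
  rewrite !lft_pr, !rgt_pr; cbn [nat_rect]; eauto.
Qed.

Lemma phi_Mu a x m :
  (forall i, i < m -> exists k, phi a (pr x i) (S k)) ->
  phi a (pr x m) 0 -> phi (pr 8 a) x m.
Proof.
  intros Hlt (p & <- & Hp); exists (Mu p); split; [reflexivity|].
  split; [exact Hp|].
  intros i Hi; destruct (Hlt i Hi) as (k & q & Hq & Hk).
  apply code_inj in Hq; subst q; eauto.
Qed.

(** The columns from 3 on are left free for the witnesses against
    completeness. *)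
Lemma simulates_exists (g : nat -> nat -> nat) :
  exists f, simulates f /\ (forall e x y, val f e x = S y <-> phi e x y) /\
    forall i z, f (pr (3 + i) z) = g i z.
Proof.
  destruct (char_function (fun e => exists p, code p = e)) as [W HW].
  destruct graph_function as [V HV].
  destruct (char_function (fun z => forall m, m < rgt (rgt z) ->
    exists k, phi (lft z) (pr (lft (rgt z)) m) (S k))) as [M HM].
  exists (fun z => match lft z with
                   | 0 => W (rgt z)
                   | 1 => V (rgt z)
                   | 2 => M (rgt z)
                   | S (S (S i)) => g i (rgt z)
                   end).
  set (f := fun z => _).
  assert (Hvalid : forall e, valid f e <-> exists p, code p = e).
  { intros e; unfold valid, f; rewrite lft_pr, rgt_pr; apply HW. }
  assert (Hval : forall e x y, val f e x = S y <-> phi e x y).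
  { intros e x y; unfold val, f; rewrite lft_pr, rgt_pr; apply HV. }
  assert (Hnz : forall e x m, nonzero_below f e x m <->
            forall i, i < m -> exists k, phi e (pr x i) (S k)).
  { intros e x m; unfold nonzero_below, f; rewrite lft_pr, rgt_pr, HM.
    now rewrite !lft_pr, !rgt_pr, lft_pr. }
  split; [|split].
  - unfold simulates; repeat match goal with |- _ /\ _ => split end.
    1-5: apply Hvalid; eexists; reflexivity.
    + intros a b [p <-]%Hvalid [q <-]%Hvalid.
      split; [|split]; apply Hvalid;
        [exists (Pair p q) | exists (Comp p q) | exists (Prec p q)]; reflexivity.
    + intros a [p <-]%Hvalid; apply Hvalid; exists (Mu p); reflexivity.
    + intros x; repeat split; apply Hval; eexists; (split; [reflexivity|]);
        reflexivity.
    + intros a b x u v; rewrite !Hval; apply phi_Pair.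
    + intros a b x u v; rewrite !Hval; apply phi_Comp.
    + intros a b x u [q <-]%Hvalid; rewrite !Hval; apply phi_Prec_0.
    + intros a b x m u v; rewrite !Hval; apply phi_Prec_S.
    + intros a x; apply Hnz; lia.
    + intros a x m u; rewrite !Hnz, Hval; intros Hlt Hm i Hi.
      destruct (Nat.eq_dec i m) as [Him | Him]; [subst i; eauto|].
      apply Hlt; lia.
    + intros a x m; rewrite Hnz, !Hval; apply phi_Mu.
  - exact Hval.
  - intros i z; unfold f; now rewrite lft_pr, rgt_pr.
Qed.

(** * Refuting completeness *)

(** The value 1 of φ_n is stored as 2. *)
Definition holds (f : nat -> nat) (n x y : nat) : Prop := val f n (pr x y) = 2.

Definition mem (f : nat -> nat) (u : nat) : Prop := f (pr 4 u) = 1.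

(** Column 3 holds points, column 4 a set (see [mem]), and column 5 a Skolem
    function: for each [s], either a member of the set not below [s], or an upper
    bound of the set not above [s]. *)
Definition refutes (f : nat -> nat) (n : nat) : Prop :=
  simulates f /\
  let x := f (pr 3 0) in
  let y := f (pr 3 1) in
  let z := f (pr 3 2) in
  ((val f n (pr x y) <> 1 /\ val f n (pr x y) <> 2) \/
   ~ holds f n x x \/
   (holds f n x y /\ holds f n y z /\ ~ holds f n x z) \/
   (holds f n x y /\ holds f n y x /\ x <> y) \/
   (forall s, let v := f (pr 5 s) in
      (mem f v /\ ~ holds f n v s) \/
      ((forall u, mem f u -> holds f n u v) /\ ~ holds f n s v))).

Ltac solve_recursive :=
  lazymatch goal with
  | |- recursive (fun _ x => x) => apply recursive_id
  | |- recursive (fun f x => f _) => apply recursive_oracle; solve_recursive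
  | |- recursive (fun f x => pr _ _) => apply recursive_pr; solve_recursive
  | |- recursive (fun f x => lft _) => apply recursive_lft; solve_recursive
  | |- recursive (fun f x => rgt _) => apply recursive_rgt; solve_recursive
  | |- recursive (fun f x => S _) => apply recursive_succ; solve_recursive
  | |- recursive _ => apply recursive_const
  end.

Ltac solve_decidable :=
  lazymatch goal with
  | |- decidable (fun f x => _ /\ _) => apply decidable_and; solve_decidable
  | |- decidable (fun f x => _ \/ _) => apply decidable_or; solve_decidable
  | |- decidable (fun f x => ~ _) => apply decidable_not; solve_decidable
  | |- decidable (fun f x => _ = _) => apply decidable_eq; solve_recursive
  | |- decidable (fun f x => _ -> _) => apply decidable_imp; solve_decidable
  end.

Ltac solve_Pi01 :=
  lazymatch goal with
  | |- Pi01 (fun f n => _ /\ _) => apply Pi01_and; solve_Pi01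
  | |- Pi01 (fun f n => _ \/ _) => apply Pi01_or; solve_Pi01
  | |- Pi01 (fun f n => forall x : nat, _) => apply Pi01_forall; solve_Pi01
  | |- Pi01 _ => apply Pi01_decidable; solve_decidable
  end.

Lemma Pi01_refutes : Pi01 refutes.
Proof.
  unfold refutes, simulates, holds, mem, valid, val, nonzero_below; cbv zeta.
  solve_Pi01.
Qed.

(** The supremum of the set of lower bounds of [S] is an infimum of [S]. *)
Lemma sups_complete (R : relation nat) :
  (forall S, exists s, is_sup R S s) -> complete R.
Proof.
  intros H S; split; [apply H|].
  destruct (H (fun l => forall x, S x -> R l x)) as (i & Hub & Hleast).
  exists i; split; auto.
Qed.

(** Since φ_n is total with values 0 and 1, and [f] claims every true value, what
    [f] says about φ_n is correct, and each alternative in [refutes] is false. *)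
Lemma complete_not_refuted n :
  (exists R, computable_lattice_index n R /\ complete R) ->
  forall f, ~ refutes f n.
Proof.
  intros (R & [Hchar [[Hrefl Htrans Hanti] _]] & Hcomp) f [Hsim Hbad].
  assert (Hval : forall x y, (R x y /\ val f n (pr x y) = 2) \/
                             (~ R x y /\ val f n (pr x y) = 1)).
  { intros x y; destruct (Hchar x y) as [[HR (p & <- & Hp)] | [HR (p & <- & Hp)]];
      [left | right]; (split; [exact HR|]); now apply simulates_eval. }
  assert (Hholds : forall x y, holds f n x y <-> R x y).
  { intros x y; unfold holds; destruct (Hval x y) as [[HR ->] | [HR ->]];
      intuition discriminate. }
  destruct Hbad as [[N1 N2] | [N | [(H1 & H2 & N) | [(H1 & H2 & N) | Hsup]]]].
  - destruct (Hval (f (pr 3 0)) (f (pr 3 1))) as [[_ E] | [_ E]];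
      contradiction.
  - rewrite Hholds in N; apply N, Hrefl.
  - rewrite Hholds in *; apply N; eapply Htrans; eassumption.
  - rewrite Hholds in *; apply N, Hanti; assumption.
  - destruct (Hcomp (mem f)) as [(s & Hub & Hleast) _].
    destruct (Hsup s) as [[Hv N] | [Hv N]]; rewrite Hholds in N; apply N; [auto|].
    apply Hleast; intros u Hu; apply Hholds; auto.
Qed.

Lemma refutation_exists n (w : nat -> nat) (A : nat -> Prop) (v : nat -> nat) :
  exists f, simulates f /\
    (forall x y k, val f n (pr x y) = S k <-> phi n (pr x y) k) /\
    (forall i, f (pr 3 i) = w i) /\
    (forall u, mem f u <-> A u) /\
    (forall s, f (pr 5 s) = v s).
Proof.
  destruct (char_function A) as [c Hc].
  destruct (simulates_exists (fun i => match i with 0 => w | 1 => c | _ => v end))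
    as (f & Hsim & Hval & Hg).
  exists f; split; [exact Hsim|]; split; [intros; apply Hval|].
  split; [exact (Hg 0)|]; split; [|exact (Hg 2)].
  intros u; unfold mem; rewrite (Hg 1); apply Hc.
Qed.

(** Each defect of [n] that could prevent it from being an index of a complete
    lattice would give a refutation, by filling the witness columns next to the
    true graph. *)
Lemma not_refuted_complete n :
  (forall f, ~ refutes f n) ->
  exists R, computable_lattice_index n R /\ complete R.
Proof.
  intros Hno.
  set (R := fun x y => phi n (pr x y) 1).
  assert (Hno_points : forall x y z,
    ~ ((~ phi n (pr x y) 0 /\ ~ R x y) \/ ~ R x x \/
       (R x y /\ R y z /\ ~ R x z) \/ (R x y /\ R y x /\ x <> y))).
  { intros x y z H.
    destruct (refutation_exists n
      (fun i => match i with 0 => x | 1 => y | _ => z end)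
      (fun _ => True) (fun _ => 0)) as (f & Hsim & Hval & Hw & _).
    apply (Hno f); split; [exact Hsim|]; cbv zeta; unfold holds.
    rewrite !Hw, !Hval; fold (R x y) (R x x) (R y z) (R x z) (R y x); tauto. }
  assert (Hsup : forall A, exists s, is_sup R A s).
  { intros A; apply NNPP; intros N.
    assert (Hv : forall s, exists v,
      (A v /\ ~ R v s) \/ ((forall u, A u -> R u v) /\ ~ R s v)).
    { intros s; apply NNPP; intros Ns; apply N; exists s; split.
      - intros x Hx; apply NNPP; intros Nx; apply Ns; exists x; auto.
      - intros u Hu; apply NNPP; intros Nu; apply Ns; exists u; auto. }
    apply functional_choice in Hv; destruct Hv as [v Hv].
    destruct (refutation_exists n (fun _ => 0) A v)
      as (f & Hsim & Hval & _ & Hmem & Hf5).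
    apply (Hno f); split; [exact Hsim|]; cbv zeta; do 4 right.
    intros s; rewrite Hf5; unfold holds; rewrite !Hval.
    setoid_rewrite Hval; setoid_rewrite Hmem; exact (Hv s). }
  apply sups_complete in Hsup.
  exists R; split; [split; [|split; [split|]] | exact Hsup].
  - intros x y; specialize (Hno_points x y 0); fold (R x y).
    destruct (classic (R x y)); [now left | right; split; tauto].
  - intros x; specialize (Hno_points x 0 0); tauto.
  - intros x y z; specialize (Hno_points x y z); tauto.
  - intros x y; specialize (Hno_points x y 0).
    destruct (Nat.eq_dec x y); tauto.
  - intros x y; apply Hsup.
Qed.

Theorem lemma2p3 :
  Pi11 (fun e => exists R : nat -> nat -> Prop,
          computable_lattice_index e R /\ complete R).
Proof.
  destruct (Pi11_of_Pi01 refutes Pi01_refutes) as [e He].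
  exists e; intros n; rewrite <- He; split;
    [apply complete_not_refuted | apply not_refuted_complete].
Qed.
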